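(* Let $J=\{1,2,3\}$, $X=\{a,b\}$, with payoffs $u_1(a)=1,\ u_1(b)=1$; $u_2(a)=0,\ u_2(b)=-1$; $u_3(a)=-2,\ u_3(b)=1/2$. With $i(a)=i(b)=1$, both actions $x\in\{a,b\}$ satisfy $x\in z^*(\alpha(i(x)))$ and $u_{i(x)}(x)>u_j(x)$ for every $j\in J\setminus\{i(x)\}$. Nevertheless, for every $0<\lambda<1$ and $0<\delta<1$, this environment has no stationary pure-strategy MPE.
   Context: $\Delta^3=\{\alpha\in\mathbb R^3:\alpha^j\ge0,\ \sum_j\alpha^j=1\}$; $\alpha(j)$ is the vertex with weight one on $j$. $U(\alpha,x)=\sum_j\alpha^ju_j(x)$, $z^*(\alpha)=\arg\max_{x\in X}U(\alpha,x)$. A stationary pure strategy is a pair of arbitrary maps $\phi:\Delta^3\to\Delta^3$, $z:\Delta^3\to X$ (no continuity or measurability assumed). With $\phi^k$ the $k$-fold iterate, $$C_{\phi,z}(\beta;\alpha)=\sum_{k=0}^\infty\delta^k\big[(1-\lambda)U(\phi^k(\beta),z(\phi^k(\beta)))+\lambda U(\alpha,z(\phi^k(\beta)))\big].$$ A stationary pure-strategy MPE is a pair $(\phi,z)$ such that for every $\alpha\in\Delta^3$: $z(\alpha)\in z^*(\alpha)$, and $C_{\phi,z}(\phi(\alpha);\alpha)\ge C_{\phi,z}(\beta;\alpha)$ for every $\beta\in\Delta^3$. *)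

(* Defs.v *)
From mathcomp Require Import all_boot all_order all_algebra.
From mathcomp Require Import all_classical all_reals all_analysis.

Set Implicit Arguments.
Unset Strict Implicit.
Unset Printing Implicit Defensive.

Import Order.TTheory GRing.Theory Num.Theory.
Import numFieldNormedType.Exports.

Local Open Scope classical_set_scope.
Local Open Scope ring_scope.

Definition in_simplex (R : realType) (n : nat) (alpha : 'rV[R]_n) : bool :=
  [forall j, 0 <= alpha 0 j] && (\sum_j alpha 0 j == 1).

Definition simplex (R : realType) (n : nat) : Type :=
  {alpha : 'rV[R]_n | in_simplex alpha}.

Definition weight (R : realType) (n : nat) (alpha : simplex R n) (j : 'I_n) : R :=
  val alpha 0 j.

Lemma vertex_subproof (R : realType) (n : nat) (j : 'I_n) :
  in_simplex (\row_k ((k == j)%:R : R)).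
Proof.
apply/andP; split; first by apply/forallP => k; rewrite mxE ler0n.
rewrite (bigD1 j) //= big1 ?mxE ?eqxx ?addr0 // => k kj.
by rewrite mxE (negbTE kj).
Qed.

Definition vertex (R : realType) (n : nat) (j : 'I_n) : simplex R n :=
  exist _ (\row_k (k == j)%:R) (vertex_subproof R j).

Definition U (R : realType) (n : nat) (X : Type) (u : 'I_n -> X -> R)
    (alpha : simplex R n) (x : X) : R :=
  \sum_j weight alpha j * u j x.

Definition zstar (R : realType) (n : nat) (X : Type) (u : 'I_n -> X -> R)
    (alpha : simplex R n) : set X :=
  [set x | forall y, U u alpha y <= U u alpha x].

(* [limn] has a junk value on divergent sequences; for finite [X] and
   [0 < delta < 1] the terms are dominated by a geometric series, so the limit
   exists for arbitrary [phi] and [z]. *)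
Definition C (R : realType) (n : nat) (X : Type) (u : 'I_n -> X -> R)
    (lambda delta : R) (phi : simplex R n -> simplex R n) (z : simplex R n -> X)
    (beta alpha : simplex R n) : R :=
  limn (series (fun k : nat => delta ^+ k *
    ((1 - lambda) * U u (iter k phi beta) (z (iter k phi beta))
     + lambda * U u alpha (z (iter k phi beta))))).

Definition stationary_pure_MPE (R : realType) (n : nat) (X : Type)
    (u : 'I_n -> X -> R) (lambda delta : R)
    (phi : simplex R n -> simplex R n) (z : simplex R n -> X) : Prop :=
  forall alpha : simplex R n,
    zstar u alpha (z alpha) /\
    forall beta : simplex R n,
      C u lambda delta phi z beta alpha <= C u lambda delta phi z (phi alpha) alpha.

Inductive action : Type := act_a | act_b.

(* The agents 1, 2, 3 are the ordinals 0, 1, 2 of ['I_3]. *)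
Definition payoff (R : realType) (j : 'I_3) (x : action) : R :=
  match x with
  | act_a => [:: 1; 0; - 2]`_j
  | act_b => [:: 1; - 1; 2^-1]`_j
  end.

Definition agent_of (x : action) : 'I_3 :=
  match x with act_a => ord0 | act_b => ord0 end.

(* Main.v *)
Require Import Defs.
From mathcomp Require Import all_boot all_order all_algebra.
From mathcomp Require Import all_classical all_reals all_analysis.
From mathcomp Require Import ring lra.

(* Write e for the first vertex, x0 for the action chosen there and w for the
   other one. The discounted payoff V(beta) of the types visited from beta is at
   most 1/(1-delta), with equality only if every visited type is e. The type e
   therefore delegates to itself, so x0 is played forever from e. A type alpha
   at which w is better than x0 by a gap s > 0 maximizes, up to constants,
   (1-lambda) V(beta) - lambda s P(beta), where P is the discounted frequency of
   x0. It can deviate to a type of gap t arbitrarily close to e, where w is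
   chosen in the first period, at a cost in V that vanishes with t. Hence
   P(phi alpha) <= delta * sup P(phi .), the supremum being over such types near
   e; so P(phi alpha) = 0 and V(phi alpha) = 1/(1-delta). Then phi alpha = e, a
   contradiction since x0 is played forever from e. *)

Set Implicit Arguments.
Unset Strict Implicit.
Unset Printing Implicit Defensive.

Import Order.TTheory GRing.Theory Num.Theory.
Import numFieldNormedType.Exports.

Local Open Scope classical_set_scope.
Local Open Scope ring_scope.

(** * Discounted sums of bounded sequences *)

Definition discounted (R : realType) (delta : R) (u : nat -> R) : R :=
  limn (series (fun k => delta ^+ k * u k)).

Lemma cvg_discounted (R : realType) (delta K : R) (u : nat -> R) :
  0 < delta < 1 -> (forall k, `|u k| <= K) ->
  cvgn (series (fun k => delta ^+ k * u k)).
Proof.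
move=> /andP[d0 d1] uK; apply: normed_cvg.
have K0 : 0 <= K by apply: le_trans (uK 0%N).
apply: (@series_le_cvg _ _ (geometric K delta)) => [n|n|n|] /=.
- by [].
- by rewrite mulr_ge0 ?exprn_ge0 // ltW.
- by rewrite normrM mulrC normrX (gtr0_norm d0) ler_wpM2r ?exprn_ge0 // ltW.
- by apply: is_cvg_geometric_series; rewrite gtr0_norm.
Qed.

Lemma discountedDZ (R : realType) (delta K L a b : R) (u v : nat -> R) :
  0 < delta < 1 -> (forall k, `|u k| <= K) -> (forall k, `|v k| <= L) ->
  discounted delta (fun k => a * u k + b * v k) =
  a * discounted delta u + b * discounted delta v.
Proof.
move=> d01 uK vL.
have cu := cvg_discounted d01 uK; have cv := cvg_discounted d01 vL.
rewrite /discounted.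
rewrite -[a * _](lim_seriesZ a cu) -[b * _](lim_seriesZ b cv).
rewrite -lim_seriesD; [|exact: is_cvg_seriesZ..].
congr (limn (series _)); apply/funext => k /=.
change (delta ^+ k * (a * u k + b * v k) =
  a * (delta ^+ k * u k) + b * (delta ^+ k * v k)); ring.
Qed.

Lemma discounted_rec (R : realType) (delta K : R) (u : nat -> R) :
  0 < delta < 1 -> (forall k, `|u k| <= K) ->
  discounted delta u = u 0%N + delta * discounted delta (fun k => u k.+1).
Proof.
move=> d01 uK.
have cu := cvg_discounted d01 uK.
have cv := cvg_discounted d01 (fun k => uK k.+1).
rewrite -[delta * _](lim_seriesZ delta cv).
(* After the shift, the first [n.+1] terms split into [u 0] and [delta] times the first [n] terms of
   the tail. *)
apply: cvg_lim => //; rewrite -cvg_shiftS /=.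
rewrite [X in X @ _ --> _](_ : _ =
  (fun=> u 0%N) + series (delta *: (fun k => delta ^+ k * u k.+1))).
  by apply: cvgD; [exact: cvg_cst|exact: is_cvg_seriesZ].
apply/funext => n; rewrite fctE /series /= big_nat_recl // expr0 mul1r.
by congr (_ + _); apply: eq_bigr => i _; rewrite exprS -mulrA.
Qed.

Lemma le_discounted (R : realType) (delta K L : R) (u v : nat -> R) :
  0 < delta < 1 -> (forall k, `|u k| <= K) -> (forall k, `|v k| <= L) ->
  (forall k, u k <= v k) -> discounted delta u <= discounted delta v.
Proof.
move=> d01 uK vL uv; apply: lim_series_le => [||k].
- exact: cvg_discounted uK.
- exact: cvg_discounted vL.
- by rewrite ler_wpM2l // exprn_ge0 // ltW; case/andP: d01.
Qed.

Lemma discounted_cst (R : realType) (delta a : R) :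
  0 < delta < 1 -> discounted delta (fun=> a) = a / (1 - delta).
Proof.
move=> /andP[d0 d1]; apply: cvg_lim => //.
rewrite [X in series X](_ : _ = geometric a delta).
  by apply: cvg_geometric_series; rewrite gtr0_norm.
by apply/funext => k /=; rewrite mulrC.
Qed.

(** * The contradiction for an abstract delegation problem *)

(** Replaces the limit [t -> 0] in the deviations towards [e]. *)
Lemma le0_of_le_small (R : realType) (x K : R) :
  (forall t, 0 < t <= 1 -> x <= t * K) -> x <= 0.
Proof.
move=> H; case: (leP x 0) => // x0.
(* The bound at [t = 1] makes [K] positive and [x / (2 * K)] an admissible [t], at which
   [x <= x / 2]. *)
have xK : x <= K by have := H 1; rewrite mul1r ltr01 lexx; exact.
have K0 : 0 < K by exact: lt_le_trans xK.
have t01 : 0 < x / (2 * K) <= 1.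
  rewrite divr_gt0 ?mulr_gt0 //= ler_pdivrMr ?mulr_gt0 // mul1r; lra.
have := H _ t01.
have -> : x / (2 * K) * K = x / 2 by field; rewrite gt_eqF.
lra.
Qed.

(* [M] is the payoff flow with discounted sum [V], [Q] indicates the action
   chosen at [e] and [P] is its discounted frequency; a type [alpha] loses
   [c * D alpha] per unit of that frequency. *)
Lemma no_stationary_optimum (R : realType) (T : Type) (c delta : R)
    (phi : T -> T) (M Q V P D : T -> R) (e : T) :
  0 < c -> 0 < delta < 1 ->
  (forall b, V b = M b + delta * V (phi b)) ->
  (forall b, P b = Q b + delta * P (phi b)) ->
  (forall b, V b <= (1 - delta)^-1) ->
  (forall b, 0 <= P b) -> (forall b, P b <= (1 - delta)^-1) ->
  M e = 1 -> (forall b, 1 <= M b -> b = e) -> D e = 0 -> Q e = 1 ->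
  (forall s, 0 < s <= 1 -> exists b, [/\ D b = s, Q b = 0 & 1 - s <= M b]) ->
  (forall alpha b, V b - c * D alpha * P b <=
     V (phi alpha) - c * D alpha * P (phi alpha)) ->
  False.
Proof.
set N := (1 - delta)^-1.
move=> c0 /andP[d0 d1] VE PE VN P0 PN Me M1 De Qe fam opt.
have NE : 1 + delta * N = N by rewrite /N; field; rewrite subr_eq0 gt_eqF.
have N0 : 0 < N by rewrite invr_gt0 subr_gt0.
have eqe b : N <= V b -> b = e.
  move=> NV; apply: M1.
  have : delta * V (phi b) <= delta * N by rewrite ler_pM2l.
  by have := VE b; lra.
(* As [D e = 0], type [e] maximizes [V] alone; comparing with the choice of [e] itself gives
   [V (phi e) >= 1 + delta * V (phi e)]. *)
have Vphie : N <= V (phi e).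
  have := opt e e; have := VE e; rewrite Me De mulr0 !mul0r !subr0 => -> H.
  by rewrite /N -div1r ler_pdivrMr ?subr_gt0 //; lra.
have phie : phi e = e by exact: eqe.
have Ve : V e = N by apply/eqP; rewrite eq_le VN -phie.
have Pe : P e = N.
  have d1' : 1 - delta != 0 by rewrite subr_eq0 gt_eqF.
  by apply: (mulfI d1'); rewrite mulfV //; have := PE e; rewrite Qe phie; lra.
pose good b := [/\ 0 < D b, Q b = 0 & 1 - D b <= M b].
(* Deviating to [e] yields [V = P = N], so the shortfall of [V (phi b)] below [N] is at most of
   order [D b]. *)
have Vphi b : N - c * D b * N <= V (phi b) - c * D b * P (phi b).
  by have := opt b e; rewrite Ve Pe.
(* Type [b] deviates to a good [b'] with [D b' = t]. Then [P b' <= delta * B], since [x0] is not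
   played in the first period, and [V b' >= N - t * (1 + delta * (c * N))]; let [t] tend to 0. *)
have key B b : (forall b', good b' -> P (phi b') <= B) -> good b ->
    c * D b * (P (phi b) - delta * B) + (N - V (phi b)) <= 0.
  move=> PB [Db _ _]; have cD : 0 < c * D b by rewrite mulr_gt0.
  apply: (@le0_of_le_small _ _ (1 + delta * (c * N))) => t t01.
  have [b' [Db' Qb' Mb']] := fam t t01.
  have {t01}/andP[t0 _] := t01.
  have gb' : good b' by split; rewrite ?Db'.
  have Pb' : c * D b * P b' <= c * D b * (delta * B).
    by rewrite ler_pM2l // PE Qb' add0r ler_pM2l // PB.
  have Vb' : delta * (N - c * t * N) <= delta * V (phi b').
    rewrite ler_pM2l //; have := Vphi b'; rewrite Db'.
    have : 0 <= c * t * P (phi b') by rewrite mulr_ge0 // mulr_ge0 // ltW.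
    lra.
  have := opt b b'; have := VE b'.
  lra.
have [b1 [Db1 Qb1 Mb1]] := fam 1 (introT andP (conj ltr01 (lexx 1))).
have gb1 : good b1 by split; rewrite ?Db1.
pose S := [set P (phi b) | b in good].
have Sub : has_ubound S by exists N => _ [b _ <-]; exact: PN.
have PS b : good b -> P (phi b) <= sup S.
  by move=> gb; apply: ub_le_sup => //; exists b.
(* Both summands in [key] matter: here [V <= N] discards the second one and bounds [P]; once [P] is
   known to vanish, the second one bounds [V] from below. *)
have PdS b : good b -> P (phi b) <= delta * sup S.
  move=> gb; have := key _ _ PS gb; case: (gb) => Db _ _ H.
  have : c * D b * (P (phi b) - delta * sup S) <= 0 by have := VN (phi b); lra.
  by rewrite pmulr_rle0 ?mulr_gt0 // subr_le0.
have S0 : sup S <= 0.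
  have : sup S <= delta * sup S.
    by apply: ge_sup => [|_ [b gb <-]]; [exists (P (phi b1)); exists b1|exact: PdS].
  move=> H; have : (1 - delta) * sup S <= 0 by lra.
  by rewrite pmulr_rle0 // subr_gt0.
have PB0 b : good b -> P (phi b) <= 0 by move=> /PS /le_trans; exact.
have P10 : P (phi b1) = 0 by apply/eqP; rewrite eq_le P0 PB0.
(* With [B = 0] the first summand is zero, so [V (phi b1) >= N] and [phi b1 = e], where [P] equals
   [N > 0]. *)
have := key 0 b1 PB0 gb1; rewrite P10 mulr0 subr0 mulr0 add0r subr_le0.
move=> /eqe phib1; move: P10; rewrite phib1 Pe => N00.
by move: N0; rewrite N00 ltxx.
Qed.

(** * Payoffs in the three-agent environment *)

Section Environment.
Variable R : realType.
Implicit Types alpha : simplex R 3.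

Let j0 : 'I_3 := ord0.
Let j1 : 'I_3 := lift ord0 ord0.
Let j2 : 'I_3 := lift ord0 (lift ord0 ord0).

Lemma U_act_a alpha :
  U (@payoff R) alpha act_a = weight alpha j0 - 2 * weight alpha j2.
Proof. rewrite /U !big_ord_recl big_ord0 /=; lra. Qed.

Lemma U_act_b alpha : U (@payoff R) alpha act_b =
  weight alpha j0 - weight alpha j1 + weight alpha j2 / 2.
Proof. rewrite /U !big_ord_recl big_ord0 /=; lra. Qed.

Lemma weights3 alpha : [/\ 0 <= weight alpha j0, 0 <= weight alpha j1,
  0 <= weight alpha j2 & weight alpha j0 + weight alpha j1 + weight alpha j2 = 1].
Proof.
rewrite /weight; have /andP[/forallP H /eqP] := valP alpha.
by rewrite !big_ord_recl big_ord0 addr0 addrA; split.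
Qed.

Lemma weights_vertex : [/\ weight (vertex R j0) j0 = 1,
  weight (vertex R j0) j1 = 0 & weight (vertex R j0) j2 = 0].
Proof. by rewrite /weight /= !mxE. Qed.

Lemma weights_inj alpha beta :
  weight alpha j0 = weight beta j0 -> weight alpha j1 = weight beta j1 ->
  weight alpha j2 = weight beta j2 -> alpha = beta.
Proof.
move=> h0 h1 h2; apply: val_inj; apply/rowP => j.
case: (unliftP ord0 j) => [j' ->|-> //].
case: (unliftP ord0 j') => [j'' ->|-> //].
by rewrite (ord1 j'').
Qed.

Lemma simplex3 (a b c : R) : 0 <= a -> 0 <= b -> 0 <= c -> a + b + c = 1 ->
  exists alpha,
    [/\ weight alpha j0 = a, weight alpha j1 = b & weight alpha j2 = c].
Proof.
move=> a0 b0 c0 abc.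
have H : in_simplex (\row_(k < 3) [:: a; b; c]`_k).
  apply/andP; split; last first.
    by rewrite !big_ord_recl big_ord0 !mxE /= addr0 addrA abc.
  by apply/forallP => k; rewrite mxE; case: k => [[|[|[]]]].
by exists (exist (fun al => in_simplex al) _ H); rewrite /weight /= !mxE.
Qed.

Lemma U_bound alpha x : `|U (@payoff R) alpha x| <= 2.
Proof.
have [h0 h1 h2 h] := weights3 alpha.
by rewrite ler_norml; case: x; rewrite ?U_act_a ?U_act_b; apply/andP; split; lra.
Qed.

Lemma U_le1 alpha x : U (@payoff R) alpha x <= 1.
Proof.
have [h0 h1 h2 h] := weights3 alpha.
by case: x; rewrite ?U_act_a ?U_act_b; lra.
Qed.

Lemma U_vertex0 x : U (@payoff R) (vertex R j0) x = 1.
Proof.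
have [h0 h1 h2] := weights_vertex.
by case: x; rewrite ?U_act_a ?U_act_b h0 ?h1 h2; lra.
Qed.

(** Under either action agents 2 and 3 get strictly less than 1, so an average of 1 leaves them no
    weight. *)
Lemma U_eq1 alpha x : 1 <= U (@payoff R) alpha x -> alpha = vertex R j0.
Proof.
have [h0 h1 h2 h] := weights3 alpha; have [e0 e1 e2] := weights_vertex.
case: x; rewrite ?U_act_a ?U_act_b => H;
  by apply: weights_inj; rewrite ?e0 ?e1 ?e2; lra.
Qed.

Definition other (x : action) : action :=
  match x with act_a => act_b | act_b => act_a end.

Lemma other_neq x : other x <> x. Proof. by case: x. Qed.

Lemma neq_other x y : x <> y -> x = other y. Proof. by case: x y => [] []. Qed.

Definition gap (x0 : action) alpha : R :=
  U (@payoff R) alpha (other x0) - U (@payoff R) alpha x0.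

(** Whichever action is chosen at the vertex, some agent strictly prefers the other: agent 3 prefers
    [act_b] by 5/2, hence the weight [s * (2 / 5)], and agent 2 prefers [act_a] by 1. Mixing that
    agent with agent 1 gives the type. *)
Lemma near_vertex0 x0 s : 0 < s <= 1 -> exists alpha,
  gap x0 alpha = s /\ 1 - s <= U (@payoff R) alpha (other x0).
Proof.
move=> /andP[s0 s1]; case: x0.
- have [||||al [h0 h1 h2]] := @simplex3 (1 - s * (2 / 5)) 0 (s * (2 / 5)); try lra.
  by exists al; rewrite /gap /= U_act_a U_act_b h0 h1 h2; split; lra.
- have [||||al [h0 h1 h2]] := @simplex3 (1 - s) s 0; try lra.
  by exists al; rewrite /gap /= U_act_a U_act_b h0 h1 h2; split; lra.
Qed.

(** * Continuation payoffs under a given strategy *)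

Section Strategy.
Variables (delta : R) (phi : simplex R 3 -> simplex R 3).
Variables (z : simplex R 3 -> action) (x0 : action).
Hypothesis delta01 : 0 < delta < 1.

Definition own beta : R := U (@payoff R) beta (z beta).

Definition plays beta : R := `[< z beta = x0 >]%:R.

(** Applied to [own] and [plays], this gives the [V] and [P] of the abstract problem. *)
Definition value (f : simplex R 3 -> R) beta : R :=
  discounted delta (fun k => f (iter k phi beta)).

Lemma plays_bound beta : `|plays beta| <= 1.
Proof. by rewrite /plays; case: `[< _ >]; rewrite ?normr1 ?normr0. Qed.

Lemma value_rec (f : simplex R 3 -> R) K beta : (forall b, `|f b| <= K) ->
  value f beta = f beta + delta * value f (phi beta).
Proof.
move=> fK; rewrite /value (discounted_rec delta01 (fun k => fK (iter k phi beta))) /=.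
by under [in RHS]eq_fun do rewrite -iterSr.
Qed.

(** With two actions, the payoff of [alpha] is affine in the indicator of [x0], so [beta] enters
    only through two discounted sums. *)
Lemma C_value lambda beta alpha :
  C (@payoff R) lambda delta phi z beta alpha =
  (1 - lambda) * value own beta + lambda *
    (U (@payoff R) alpha (other x0) / (1 - delta) - gap x0 alpha * value plays beta).
Proof.
have UE b : U (@payoff R) alpha (z b) =
    U (@payoff R) alpha (other x0) * 1 + - gap x0 alpha * plays b.
  rewrite /plays; case: asboolP => [->|/neq_other ->];
    rewrite /gap /= ?mulr1n ?mulr0n; ring.
transitivity (discounted delta (fun k => (1 - lambda) * own (iter k phi beta) +
    lambda * U (@payoff R) alpha (z (iter k phi beta)))); first by [].
rewrite (discountedDZ _ _ delta01 (fun k => U_bound _ _) (fun k => U_bound _ _)).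
congr (_ + lambda * _).
under eq_fun do rewrite UE.
have one_bound (k : nat) : `|1 : R| <= 1 by rewrite normr1.
rewrite (discountedDZ _ _ delta01 one_bound (fun k => plays_bound _)).
by rewrite discounted_cst // div1r mulNr.
Qed.

Lemma own_value_le beta : value own beta <= (1 - delta)^-1.
Proof.
rewrite -div1r -discounted_cst //.
have one_bound (k : nat) : `|1 : R| <= 1 by rewrite normr1.
by apply: (le_discounted delta01 (fun k => U_bound _ _) one_bound) => k; exact: U_le1.
Qed.

Lemma plays_value_ge0 beta : 0 <= value plays beta.
Proof.
rewrite -[0](mul0r (1 - delta)^-1) -discounted_cst //.
have zero_bound (k : nat) : `|0 : R| <= 0 by rewrite normr0.
by apply: (le_discounted delta01 zero_bound (fun k => plays_bound _)) => k; exact: ler0n.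
Qed.

Lemma plays_value_le beta : value plays beta <= (1 - delta)^-1.
Proof.
rewrite -div1r -discounted_cst //.
have one_bound (k : nat) : `|1 : R| <= 1 by rewrite normr1.
apply: (le_discounted delta01 (fun k => plays_bound _) one_bound) => k.
by rewrite /plays lern1 leq_b1.
Qed.

End Strategy.

(** * Reduction of an equilibrium to the abstract problem *)

Lemma no_MPE (lambda delta : R) (phi : simplex R 3 -> simplex R 3)
    (z : simplex R 3 -> action) :
  0 < lambda < 1 -> 0 < delta < 1 ->
  ~ stationary_pure_MPE (@payoff R) lambda delta phi z.
Proof.
move=> /andP[l0 l1] d01 mpe; pose x0 := z (vertex R j0).
apply: (@no_stationary_optimum R (simplex R 3) (lambda / (1 - lambda)) delta phi
  (own z) (plays z x0) (value delta phi (own z)) (value delta phi (plays z x0))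
  (gap x0) (vertex R j0)) => //.
- by rewrite divr_gt0 // subr_gt0.
- by move=> b; apply: (value_rec _ d01) => b'; exact: U_bound.
- by move=> b; apply: (value_rec _ d01) => b'; exact: plays_bound.
- by move=> b; exact: own_value_le.
- by move=> b; exact: plays_value_ge0.
- by move=> b; exact: plays_value_le.
- exact: U_vertex0.
- by move=> b /U_eq1.
- by rewrite /gap !U_vertex0 subrr.
- by rewrite /plays; case: asboolP.
- move=> s s01; have [b [gb Ub]] := near_vertex0 x0 s01.
  (* The gap [s] is positive, so [x0] is not optimal at [b]. *)
  have zb : z b = other x0.
    apply: neq_other => zb; have := (mpe b).1 (other x0); rewrite zb.
    by have /andP[s0 _] := s01; rewrite -subr_le0 -/(gap x0 b) gb; lra.
  exists b; split => //; last by rewrite /own zb.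
  by rewrite /plays zb; case: asboolP => // /other_neq.
- move=> alpha b; have := (mpe alpha).2 b.
  rewrite !(C_value phi z x0 d01).
  have l1' : 0 < 1 - lambda by rewrite subr_gt0.
  (* Scaling by [1 - lambda] turns the coefficient [lambda / (1 - lambda)] into [lambda]; the term
     of [C] free of [beta] cancels. *)
  move=> H; rewrite -(ler_pM2l l1').
  have E x y : (1 - lambda) * (x - lambda / (1 - lambda) * gap x0 alpha * y) =
      (1 - lambda) * x - lambda * (gap x0 alpha * y).
    by field; rewrite gt_eqF.
  by rewrite !E; move: H; lra.
Qed.

End Environment.

Theorem theorem7 (R : realType) :
  (forall x : action,
     zstar (@payoff R) (vertex R (agent_of x)) x /\
     (forall j : 'I_3, j != agent_of x ->
        payoff R j x < payoff R (agent_of x) x)) /\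
  (forall lambda delta : R, 0 < lambda < 1 -> 0 < delta < 1 ->
     ~ exists (phi : simplex R 3 -> simplex R 3) (z : simplex R 3 -> action),
         stationary_pure_MPE (@payoff R) lambda delta phi z).
Proof.
split=> [x|lambda delta l01 d01 [phi [z]]]; last exact: no_MPE.
have -> : agent_of x = ord0 by case: x.
split=> [y|j]; first by rewrite !U_vertex0.
by case: x; case: j => [[|[|[]]]] //= _ _; lra.
Qed.
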